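(* Let $n\ge 1$ and $a\ge 1$ be integers, $F$ a field, $S=F[x_1,\dots,x_n]$ and $R=F[x_1,\dots,x_n]/(x_1^a)$. Let $t\ge a$, let $M$ be a set of monomials in $R_t$, and let $B$ denote the set of all monomials in $S_t$ that are divisible by $x_1^a$. Then $M$ is Gotzmann in $R_t$ if and only if $B\sqcup M$ is Gotzmann in $S_t$.
   Context: All variables have degree $1$; $S_t$ and $R_t$ denote the homogeneous components of degree $t$. Monomials of $R$ are identified with the monomials of $S$ not divisible by $x_1^a$, so a set of monomials in $R$ is also regarded as a set of monomials in $S$. Monomials are ordered lexicographically with $x_1>\dots>x_n$. A set $L$ of monomials in $S_t$ (resp. $R_t$) is lexsegment if whenever $m\in L$ and $v$ is a monomial in $S_t$ (resp. $R_t$) with $v>m$, then $v\in L$. For a set $M$ of monomials in $S_t$ (resp. $R_t$), $\operatorname{lex}_S(M)$ (resp. $\operatorname{lex}_R(M)$) is the lexsegment set in $S_t$ (resp. $R_t$) with $|M|$ elements. $S_1\cdot M$ is the set of monomials $um$ with $u$ a variable and $m\in M$; for $M\subseteq R_t$, $R_1\cdot M$ is the set of those monomials in $S_1\cdot M$ that are nonzero in $R$ (i.e. not divisible by $x_1^a$). A set $M$ of monomials in $S_t$ is Gotzmann (in $S_t$) if $|S_1\cdot \operatorname{lex}_S(M)|=|S_1\cdot M|$; a set $M$ of monomials in $R_t$ is Gotzmann (in $R_t$) if $|R_1\cdot \operatorname{lex}_R(M)|=|R_1\cdot M|$. *)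

(* Defs.v *)
From mathcomp Require Export all_boot all_order all_algebra finmap mpoly.

Set Implicit Arguments.
Unset Strict Implicit.
Unset Printing Implicit Defensive.

Import Order.TTheory GRing.Theory.

Local Open Scope fset_scope.

(* Monomials are identified with their exponent vectors, of type 'X_{1..n}.
   Their product is (_ + _)%MM, divisibility is (_ <= _)%MM, and x_1 is the
   variable of index ord0; the ring R is F[x_1,...,x_n.+1] / (x_1^a).  Neither
   the monomials nor their products depend on F: see mpolyX_mulU and
   mpolyX_dvdx1. *)

(* Lexicographic order with x_1 > ... > x_n; the library order (_ < _)%O on
   'X_{1..n} compares degrees first, see mlex_ltE. *)
Definition mlex_lt n (m v : 'X_{1..n}) : bool :=
  [exists i : 'I_n, [forall j : 'I_n, (j < i)%N ==> (m j == v j)]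
                    && (m i < v i)%N].

Definition monS n t : {fset 'X_{1..n}} :=
  [fset val m | m in [pred m : 'X_{1..n < t.+1} | mdeg m == t]].

Definition x1pow_dvd n a (m : 'X_{1..n.+1}) : bool :=
  ((U_(ord0) *+ a)%MM <= m)%MM.

Definition monR n a t : {fset 'X_{1..n.+1}} :=
  [fset m in monS n.+1 t | ~~ x1pow_dvd a m].

(* A is the set of all monomials of S_t, or of R_t. *)
Definition lexsegment n (A L : {fset 'X_{1..n}}) : bool :=
  (L `<=` A) &&
  all (fun m => all (fun v => mlex_lt m v ==> (v \in L)) A) L.

(* The lexsegment set in A with #|` M| elements; existence and uniqueness are
   lexsetP and lexset_uniq. *)
Definition lexset n (A M : {fset 'X_{1..n}}) : {fset 'X_{1..n}} :=
  head fset0 [seq L <- fpowerset A | lexsegment A L & #|` L| == #|` M|].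

Definition shiftS n (M : {fset 'X_{1..n}}) : {fset 'X_{1..n}} :=
  [fset (U_(i) + m)%MM | i in 'I_n, m in M].

Definition shiftR n a (M : {fset 'X_{1..n.+1}}) : {fset 'X_{1..n.+1}} :=
  [fset m in shiftS M | ~~ x1pow_dvd a m].

Definition gotzmannS n t (M : {fset 'X_{1..n}}) : Prop :=
  #|` shiftS (lexset (monS n t) M)| = #|` shiftS M|.

Definition gotzmannR n a t (M : {fset 'X_{1..n.+1}}) : Prop :=
  #|` shiftR a (lexset (monR n a t) M)| = #|` shiftR a M|.

Lemma in_monS n t (m : 'X_{1..n}) : (m \in monS n t) = (mdeg m == t).
Proof.
apply/imfsetP/eqP => [[x /= /eqP xt ->//]|mt].
have mlt : (mdeg m < t.+1)%N by rewrite mt.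
by exists (BMultinom mlt) => //; apply/eqP.
Qed.

Lemma in_monR n a t (m : 'X_{1..n.+1}) :
  (m \in monR n a t) = (mdeg m == t) && (m ord0 < a)%N.
Proof.
rewrite !inE /= in_monS; congr (_ && _).
rewrite ltnNge; congr (~~ _); apply/mnm_lepP/idP => [/(_ ord0)|le i].
  by rewrite mulmnE mnm1E eqxx mul1n.
by rewrite mulmnE mnm1E; case: eqP => [<-|_]; rewrite ?mul1n ?mul0n.
Qed.

Lemma mlex_ltE n (m v : 'X_{1..n}) :
  mdeg m = mdeg v -> mlex_lt m v = (m < v)%O.
Proof.
move=> e; apply/existsP/ltmcP => // -[i].
  case/andP=> /forallP h lt; exists i => // j ji.
  by apply/eqP; move: (h j); rewrite ji.
move=> h lt; exists i; rewrite lt andbT; apply/forallP => j.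
by apply/implyP => /h ->.
Qed.

Lemma lexsegmentP n (A L : {fset 'X_{1..n}}) :
  reflect (L `<=` A /\ forall m v, m \in L -> v \in A -> mlex_lt m v -> v \in L)
          (lexsegment A L).
Proof.
apply: (iffP andP) => -[sLA h]; split=> //.
  by move=> m v mL vA lt; move/allP: h => /(_ m mL)/allP/(_ v vA)/implyP; apply.
by apply/allP => m mL; apply/allP => v vA; apply/implyP; apply: h.
Qed.

Lemma lexsegment_uniq n t (A L L' : {fset 'X_{1..n}}) : A `<=` monS n t ->
  lexsegment A L -> lexsegment A L' -> #|` L| = #|` L'| -> L = L'.
Proof.
move=> sA; wlog suff W : L L' / lexsegment A L -> lexsegment A L' ->
    #|` L| = #|` L'| -> L `<=` L'.
  by move=> lL lL' e; apply/eqP; rewrite eqEfcard W //= e.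
move=> /lexsegmentP[sL lL] /lexsegmentP[sL' lL'] e; apply: contraT.
case/fsubsetPn => m mL mL'.
suff: L' `<` L by move/fproper_ltn_card; rewrite e ltnn.
rewrite fproperE; apply/andP; split; last first.
  by apply/fsubsetPn; exists m.
apply/fsubsetP => v vL'; have vA := fsubsetP sL' _ vL'.
have mA := fsubsetP sL _ mL.
have dg : mdeg m = mdeg v.
  by move: (fsubsetP sA _ vA) (fsubsetP sA _ mA); rewrite !in_monS => /eqP-> /eqP->.
have [|lt|eq] := ltgtP m v; first by rewrite -mlex_ltE //; apply: lL.
  by case/negP: mL'; apply: lL' vL' mA _; rewrite mlex_ltE.
by rewrite -eq.
Qed.

Lemma lexsegment_exists n t (A : {fset 'X_{1..n}}) k : A `<=` monS n t ->
  (k <= #|` A|)%N -> exists2 L, lexsegment A L & #|` L| = k.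
Proof.
move=> sA; elim: k => [|k IH] kA.
  exists fset0; last exact: cardfs0.
  by apply/lexsegmentP; split; [apply: fsub0set|].
have [L /lexsegmentP[sL lL] cL] := IH (ltnW kA).
have /fset0Pn[x0 x0P] : A `\` L != fset0.
  by rewrite -cardfs_gt0 cardfsDS // cL subn_gt0.
pose s := sort (fun x y : 'X_{1..n} => (y <= x)%O) (A `\` L).
have ms x : (x \in s) = (x \in A `\` L) by rewrite mem_sort.
have ss : sorted (fun x y : 'X_{1..n} => (y <= x)%O) s.
  by apply: sort_sorted => x y; rewrite orbC le_total.
case: s ms ss => [|v s] ms ss; first by rewrite -ms in x0P.
have : v \in A `\` L by rewrite -ms mem_head.
rewrite inE => /andP[vL vA].
have vmax w : w \in A `\` L -> (w <= v)%O.
  rewrite -ms inE => /orP[/eqP->//|ws].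
  have tr : transitive (fun x y : 'X_{1..n} => (y <= x)%O).
    by move=> y x z yx zy; apply: le_trans zy yx.
  exact: (allP (order_path_min tr ss)).
exists (v |` L); last by rewrite cardfsU1 vL cL.
apply/lexsegmentP; split; first by rewrite fsubUset fsub1set vA.
move=> m w; rewrite !in_fset1U => /orP[/eqP->|mL] wA lt; last first.
  by rewrite (lL m w) ?orbT.
have [//|wL] := boolP (w \in L); first by rewrite orbT.
have := vmax w; rewrite inE wL wA => /(_ isT).
move: lt; rewrite mlex_ltE ?ltNge => [/negP//|].
by move: (fsubsetP sA _ vA) (fsubsetP sA _ wA); rewrite !in_monS => /eqP-> /eqP->.
Qed.

Lemma lexsetP n t (A M : {fset 'X_{1..n}}) : A `<=` monS n t -> M `<=` A ->
  lexsegment A (lexset A M) /\ #|` lexset A M| = #|` M|.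
Proof.
move=> sA /fsubset_leq_card /(lexsegment_exists sA)[L lL cL].
rewrite /lexset; set s := filter _ _.
have Ls : L \in s.
  rewrite mem_filter lL cL eqxx fpowersetE /=.
  by case/lexsegmentP: lL.
have : head fset0 s \in s by case: s Ls => // *; apply: mem_head.
by rewrite mem_filter => /andP[/andP[? /eqP ?] _].
Qed.

Lemma lexset_uniq n t (A M L : {fset 'X_{1..n}}) :
  A `<=` monS n t -> M `<=` A ->
  lexsegment A L -> #|` L| = #|` M| -> lexset A M = L.
Proof.
move=> sA sM lL cL; have [lex_seg lex_card] := lexsetP sA sM.
by apply: lexsegment_uniq sA lex_seg lL _; rewrite cL.
Qed.

Lemma mpolyX_mulU n (F : fieldType) (i : 'I_n) (m : 'X_{1..n}) :
  ('X_[U_(i) + m] = 'X_i * 'X_[m] :> {mpoly F[n]})%R.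
Proof. exact: mpolyXD. Qed.

Lemma mpolyX_dvdx1 n (F : fieldType) a (m : 'X_{1..n.+1}) :
  x1pow_dvd a m <->
  (exists q : {mpoly F[n.+1]}, 'X_[m] = q * 'X_ord0 ^+ a)%R.
Proof.
rewrite /x1pow_dvd mpolyXn; split=> [le|[q e]].
  by exists 'X_[m - U_(ord0) *+ a]%R; rewrite -mpolyXD submK.
have : m \in msupp (q * 'X_[U_(ord0) *+ a])%R by rewrite -e msuppX inE.
by rewrite (perm_mem (msuppMX _ _)) => /mapP[k _ ->]; apply: lem_addr.
Qed.

(* Main.v *)
Require Import Defs.
Local Open Scope fset_scope.

(** Let [B_t] be the set of monomials of degree [t] divisible by [x_1^a]
    ([monB] below).  Two facts reduce Gotzmann sets of [R_t] to Gotzmann sets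
    of [S_t].

    - [x_1] is the largest variable, so [B_t] is an initial lexsegment of [S_t]
      and [R_t] is what comes after it.  Hence the lexsegment of [S_t] with the
      cardinality of [B_t] and [M] together is the union of [B_t] and the
      lexsegment of [R_t] with the cardinality of [M] ([lexset_monBU]).
    - As [t >= a], the products of variables and elements of [B_t] are all of
      [B_(t+1)], so for every set [N] of monomials of [S_t] the products of
      variables and elements of the union of [B_t] and [N] are the disjoint
      union of [B_(t+1)] and [R_1 N]: their number exceeds that of [R_1 N] by
      [|B_(t+1)|], which does not depend on [N]
      ([card_shiftS_monBU]).

    Applying the second fact to [N = M] and to [N = lex_R(M)] gives the two
    sides of the Gotzmann condition in [S_t], each equal to its counterpart in
    [R_t] plus [|B_(t+1)|]; the constant cancels. *)

Definition monB n a t : {fset 'X_{1..n.+1}} :=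
  [fset m in monS n.+1 t | x1pow_dvd a m].

Lemma x1pow_dvdE n a (m : 'X_{1..n.+1}) : x1pow_dvd a m = (a <= m ord0)%N.
Proof.
apply/mnm_lepP/idP => [/(_ ord0)|le i].
  by rewrite mulmnE mnm1E eqxx mul1n.
by rewrite mulmnE mnm1E; case: eqP => [<-|_]; rewrite ?mul1n ?mul0n.
Qed.

Lemma in_monB n a t (m : 'X_{1..n.+1}) :
  (m \in monB n a t) = (mdeg m == t) && (a <= m ord0)%N.
Proof. by rewrite !inE /= in_monS x1pow_dvdE. Qed.

Lemma monB_sub n a t : monB n a t `<=` monS n.+1 t.
Proof. by apply/fsubsetP => m; rewrite in_monB in_monS => /andP[]. Qed.

Lemma monR_sub n a t : monR n a t `<=` monS n.+1 t.
Proof. by apply/fsubsetP => m; rewrite in_monR in_monS => /andP[]. Qed.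

Lemma monS_split n a t : monS n.+1 t = monB n a t `|` monR n a t.
Proof.
apply/fsetP => m; rewrite in_fsetU in_monB in_monR in_monS ltnNge.
by rewrite -andb_orr orbN andbT.
Qed.

Lemma monBR_disjoint n a t : [disjoint monB n a t & monR n a t].
Proof.
apply/fdisjointP => m; rewrite in_monB in_monR => /andP[-> le].
by rewrite ltnNge le.
Qed.

Lemma cardfsU_monB n a t (N : {fset 'X_{1..n.+1}}) : N `<=` monR n a t ->
  #|` monB n a t `|` N| = (#|` monB n a t| + #|` N|)%N.
Proof.
move=> sN; rewrite cardfsU.
have/eqP -> : monB n a t `&` N == fset0.
  by rewrite fsetI_eq0; apply: fdisjointWr sN (monBR_disjoint n a t).
by rewrite cardfs0 subn0.
Qed.

Lemma mlex_lt_ord0 n (m v : 'X_{1..n.+1}) :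
  mlex_lt m v -> (m ord0 <= v ord0)%N.
Proof.
case/existsP => i /andP[/forallP h lt].
have [i0|i0] := posnP i.
  by have <- : i = ord0; [apply: val_inj | apply: ltnW].
by move/implyP: (h ord0) => /(_ i0)/eqP ->.
Qed.

(** Nothing of [R_t] exceeds an element of [B_t], because the exponent of [x_1]
    is compared before all others. *)
Lemma lexsegment_monBU n a t (L : {fset 'X_{1..n.+1}}) :
  lexsegment (monR n a t) L -> lexsegment (monS n.+1 t) (monB n a t `|` L).
Proof.
case/lexsegmentP => sL lL; apply/lexsegmentP; split.
  by rewrite fsubUset monB_sub (fsubset_trans sL (monR_sub n a t)).
move=> m v; rewrite (monS_split n a t) !in_fsetU => mBL /orP[->//|vR] lt.
case/orP: mBL => [mB|mL]; last by rewrite (lL m v) ?orbT.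
move: mB vR; rewrite in_monB in_monR => /andP[_ am] /andP[_].
by rewrite ltnNge (leq_trans am (mlex_lt_ord0 _ _ _ lt)).
Qed.

Lemma lexset_monBU n a t (M : {fset 'X_{1..n.+1}}) : M `<=` monR n a t ->
  lexset (monS n.+1 t) (monB n a t `|` M)
    = monB n a t `|` lexset (monR n a t) M.
Proof.
move=> sM; have [lL cL] := lexsetP (monR_sub n a t) sM.
apply: (@lexset_uniq _ t) => //.
- by rewrite (monS_split n a t) fsetUS.
- exact: lexsegment_monBU.
- by case/lexsegmentP: lL => sL _; rewrite !cardfsU_monB ?cL.
Qed.

Lemma shiftSP n (N : {fset 'X_{1..n}}) (m : 'X_{1..n}) :
  reflect (exists i, exists2 k, k \in N & m = (U_(i) + k)%MM) (m \in shiftS N).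
Proof.
apply: (iffP (imfset2P _ _ _ _ _)) => [[i _ [k kN ->]]|[i [k kN ->]]].
  by exists i, k.
by exists i => //; exists k.
Qed.

Lemma shiftSU n (N N' : {fset 'X_{1..n}}) :
  shiftS (N `|` N') = shiftS N `|` shiftS N'.
Proof.
apply/fsetP => m; rewrite in_fsetU; apply/shiftSP/orP.
  case=> i [k]; rewrite in_fsetU => /orP[] kN ->; [left|right];
  by apply/shiftSP; exists i, k.
by case=> /shiftSP[i [k kN ->]]; exists i, k; rewrite // in_fsetU kN ?orbT.
Qed.

Lemma shiftS_sub n t (N : {fset 'X_{1..n}}) :
  N `<=` monS n t -> shiftS N `<=` monS n t.+1.
Proof.
move=> sN; apply/fsubsetP => m /shiftSP[i [k kN ->]].
by move/fsubsetP/(_ _ kN): sN; rewrite !in_monS mdegD mdeg1 add1n eqSS.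
Qed.

(** A monomial of degree [t.+1 > a] divisible by [x_1^a] has a variable beyond
    this factor, and removing that variable leaves an element of [B_t]. *)
Lemma shiftS_monB n a t : (a <= t)%N -> shiftS (monB n a t) = monB n a t.+1.
Proof.
move=> leat; apply/eqP; rewrite eqEfsubset; apply/andP; split.
  apply/fsubsetP => m /shiftSP[i [k kB ->]]; move: kB.
  rewrite !in_monB mdegD mdeg1 add1n eqSS mnmDE => /andP[-> le] /=.
  exact: leq_trans le (leq_addl _ _).
apply/fsubsetP => m; rewrite in_monB => /andP[/eqP dm am].
pose k := (m - U_(ord0) *+ a)%MM.
have mE : m = (k + U_(ord0) *+ a)%MM.
  by rewrite submK // -/(x1pow_dvd a m) x1pow_dvdE.
have k_neq0 : k != 0%MM.
  apply/eqP => k0; move: dm leat; rewrite mE k0 mdegD mdeg0 mdegMn mdeg1 mul1n.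
  by rewrite add0n => ->; rewrite ltnn.
have [i ki] : exists i, k i != 0%N.
  apply/existsP; apply: contraR k_neq0 => /existsPn k0; apply/eqP/mnmP => i.
  by rewrite mnm0E; apply/eqP; rewrite -[_ == _]negbK.
have leUk : (U_(i) <= k)%MM by rewrite lep1mP.
have mE' : m = (U_(i) + ((k - U_(i)) + U_(ord0) *+ a))%MM.
  by rewrite addmA [(U_(i) + _)%MM]addmC submK.
apply/shiftSP; exists i, ((k - U_(i)) + U_(ord0) *+ a)%MM => //.
rewrite in_monB; apply/andP; split.
  by rewrite -eqSS -dm [in X in _ == X]mE' [in X in _ == X]mdegD mdeg1 add1n.
by rewrite mnmDE mulmnE mnm1E eqxx mul1n leq_addl.
Qed.

Lemma shiftR_sub n a t (N : {fset 'X_{1..n.+1}}) :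
  N `<=` monS n.+1 t -> shiftR a N `<=` monR n a t.+1.
Proof.
move/shiftS_sub/fsubsetP => sN; apply/fsubsetP => m.
by rewrite !inE /= => /andP[/sN -> ->].
Qed.

(** The products [x_i m], with [m] in [N], that [shiftR] drops because they
    vanish in [R] lie in [B_(t+1)], so they are not lost in the union. *)
Lemma shiftS_monBU n a t (N : {fset 'X_{1..n.+1}}) :
  (a <= t)%N -> N `<=` monS n.+1 t ->
  shiftS (monB n a t `|` N) = monB n a t.+1 `|` shiftR a N.
Proof.
move=> leat sN; rewrite shiftSU shiftS_monB //; apply/fsetP => m.
have /fsubsetP/(_ m) := shiftS_sub _ _ _ sN.
rewrite !inE /=; case: (m \in shiftS N) => [->//|_]; last by rewrite !orbF.
by rewrite orbT orbN.
Qed.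

Lemma card_shiftS_monBU n a t (N : {fset 'X_{1..n.+1}}) :
  (a <= t)%N -> N `<=` monS n.+1 t ->
  #|` shiftS (monB n a t `|` N)| = (#|` monB n a t.+1| + #|` shiftR a N|)%N.
Proof.
by move=> leat sN; rewrite shiftS_monBU // cardfsU_monB // shiftR_sub.
Qed.

Theorem theorem3 (n a t : nat) (F : fieldType)
    (M : {fset 'X_{1..n.+1}}) :
  (0 < a)%N -> (a <= t)%N ->
  M `<=` monR n a t ->
  let B := [fset m in monS n.+1 t | x1pow_dvd a m] in
  gotzmannR a t M <-> gotzmannS t (B `|` M).
Proof.
move=> _ leat sM B; rewrite /B -/(monB n a t) /gotzmannR /gotzmannS.
have [/lexsegmentP[sL _] _] := lexsetP (monR_sub n a t) sM.
have sRS := fsubset_trans _ (monR_sub n a t).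
rewrite lexset_monBU // !card_shiftS_monBU ?sRS //.
by split=> [->//|/addnI].
Qed.
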